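(* Let $a\in\mathbb C$ and $j\in\mathbb Z$. The graded subspaces of $\mathcal{SD}^{\sigma_{--,a}}$ of degrees $j$ and $j-\frac12$ are $$\mathcal{SD}^{\sigma_{--,a}}_j=\{\partial_\theta\theta\, t^jf(D)-(-1)^j\theta\partial_\theta\, t^jf(-D-j+a)\mid f\in\mathbb C[w]\},$$ $$\mathcal{SD}^{\sigma_{--,a}}_{j-1/2}=\{\theta\, t^{j-1}f(D+(j-a-1)/2)+\partial_\theta\, t^jg(D+(j-a)/2)\mid f,g\in\mathbb C^{(\overline{j})}[w]\}.$$
   Context: $\mathcal{SD}$ is the Lie superalgebra (supercommutator bracket) of the associative superalgebra over $\mathbb C$ generated by even $t^{\pm1}$, $D=t\frac{d}{dt}$ and odd $\theta,\partial_\theta$, with $f(D)t=tf(D+1)$, $\theta^2=\partial_\theta^2=0$, $\theta\partial_\theta+\partial_\theta\theta=1$, $\theta,\partial_\theta$ commuting with $t,D$. It has basis $t^kD^l$ ($k\in\mathbb Z,l\ge0$) times $\theta\partial_\theta,\partial_\theta\theta,\theta,\partial_\theta$. It is $\frac12\mathbb Z$-graded (principal gradation) by $wt(t)=1$, $wt(D)=0$, $wt(\theta)=\frac12$, $wt(\partial_\theta)=-\frac12$. The anti-involution $\sigma_{--,a}$ is the $\mathbb C$-linear map with $\sigma(XY)=(-1)^{|X||Y|}\sigma(Y)\sigma(X)$ determined by $t\mapsto -t$, $D\mapsto-D+a$, $\theta\mapsto-\theta$, $\partial_\theta\mapsto\partial_\theta$. For an anti-involution $\sigma$ put $\mathcal{SD}^\sigma=\{e\in\mathcal{SD}\mid\sigma(e)=-e\}$,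 graded by the principal gradation. $\mathbb C^{(0)}[w]$ (resp. $\mathbb C^{(1)}[w]$) is the space of even (resp. odd) polynomials in $w$; $\overline k=0$ if $k$ is odd and $\overline k=1$ if $k$ is even. *)

(* Defs.v *)
From HB Require Import structures.
From mathcomp Require Import all_boot all_order all_algebra ring.
From mathcomp Require Import finmap boolp classical_sets reals complex.
From mathcomp.multinomials Require Import monalg.
Set Implicit Arguments.
Unset Strict Implicit.
Unset Printing Implicit Defensive.
Import Order.TTheory GRing.Theory Num.Theory.
Local Open Scope ring_scope.

(* The superalgebra SD, over a field F (the complex numbers in the theorem).  *)
(* The coefficients of the powers of t are the polynomials in D with values   *)
(* in the Clifford algebra on theta, d_theta, that is, the matrices over F[D] *)
(* acting on column vectors in the basis (1, theta) of the exterior algebra:  *)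
(*   d_theta theta = E_00, d_theta = E_01, theta = E_10, theta d_theta = E_11.*)
(* An element of SD is a finite sum of terms t^k A(D), A in M_2(F[D]), and is *)
(* stored as the finitely supported map k |-> A. The relations of SD are      *)
(* proved in tSDK, DSD_tSD, thetaSD_sq, clifford_thetaSD and comm_thetaSD.    *)
Definition coefSD (F : fieldType) := 'M[{poly F}]_2.

Definition SD (F : fieldType) : Type := {malg (coefSD F)[int]}.

HB.instance Definition _ (F : fieldType) :=
  GRing.Zmodule.copy (SD F) {malg (coefSD F)[int]}.

(* A(D) |-> A(D + k), i.e. t^-k A(D) t^k *)
Definition shiftSD (F : fieldType) (k : int) (A : coefSD F) : coefSD F :=
  map_mx (comp_poly ('X + (k%:~R)%:P)) A.

Section Algebra.
Context (F : fieldType).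
Implicit Types (u v w : SD F) (k l : int) (A B : coefSD F) (c : F).

Definition termSD k A : SD F := << A *g k >>.

(* (t^k A(D)) (t^l B(D)) = t^(k+l) A(D + l) B(D) *)
Definition mulSD u v : SD F :=
  \sum_(k <- msupp u) \sum_(l <- msupp v)
    termSD (k + l) (shiftSD l u@_k * v@_l).

Definition oneSD : SD F := termSD 0 1.

Definition scaleSD c u : SD F :=
  \sum_(k <- msupp u) termSD k (c%:P *: u@_k).

HB.instance Definition _ k :=
  GRing.RMorphism.copy (@shiftSD F k)
    (map_mx (comp_poly ('X + (k%:~R)%:P)) : coefSD F -> coefSD F).

Lemma shiftSD0 A : shiftSD 0 A = A.
Proof. by apply/matrixP => i j; rewrite mxE addr0 comp_polyXr. Qed.

Lemma shiftSDD k l A : shiftSD l (shiftSD k A) = shiftSD (k + l) A.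
Proof.
apply/matrixP => i j; rewrite !mxE -comp_polyA comp_polyD comp_polyX comp_polyC.
by rewrite -addrA -polyCD -rmorphD /= addrC [l + k]addrC addrC.
Qed.

Lemma shiftSDZ k c A : shiftSD k (c%:P *: A) = c%:P *: shiftSD k A.
Proof. by apply/matrixP => i j; rewrite !mxE comp_polyM comp_polyC. Qed.

HB.instance Definition _ k :=
  GRing.Additive.copy (termSD k)
    (@mkmalgU int (coefSD F) k : coefSD F -> {malg (coefSD F)[int]}).

Lemma coefSDE k A l : (termSD k A)@_l = A *+ (k == l).
Proof. exact: mcoeffU. Qed.

Lemma termSDE u : u = \sum_(k <- msupp u) termSD k u@_k.
Proof. exact: monalgE. Qed.

Lemma SD_ext u v : (forall k, u@_k = v@_k) -> u = v.
Proof. by move/malgP. Qed.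

Lemma mulSDw (d1 d2 : {fset int}) u v :
  (msupp u `<=` d1)%fset -> (msupp v `<=` d2)%fset ->
  mulSD u v = \sum_(k <- d1) \sum_(l <- d2)
    termSD (k + l) (shiftSD l u@_k * v@_l).
Proof.
move=> le1 le2; rewrite /mulSD (big_fset_incl _ le1) /=.
  apply/eq_bigr => k _; apply/big_fset_incl => // l _ /mcoeff_outdom ->.
  by rewrite mulr0 raddf0.
move=> k _ /mcoeff_outdom uk; rewrite big1 // => l _.
by rewrite uk raddf0 mul0r raddf0.
Qed.

Lemma mulSD0r : left_zero 0 mulSD.
Proof. by move=> u; rewrite /mulSD msupp0 big_seq_fset0. Qed.

Lemma mulSDr0 : right_zero 0 mulSD.
Proof.
by move=> u; rewrite /mulSD msupp0 big1 // => k _; rewrite big_seq_fset0.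
Qed.

Lemma mulSDTT k l A B :
  mulSD (termSD k A) (termSD l B) = termSD (k + l) (shiftSD l A * B).
Proof. by rewrite (mulSDw msuppU_le msuppU_le) !big_seq_fset1 !mcoeffUU. Qed.

Lemma mulSDDl : left_distributive mulSD +%R.
Proof.
move=> u v w; pose d := (msupp u `|` msupp v)%fset.
rewrite (@mulSDw d (msupp w) u) ?fsubsetUl // (@mulSDw d (msupp w) v) ?fsubsetUr //.
rewrite (@mulSDw d (msupp w)) ?msuppD_le // -big_split /=.
apply/eq_bigr => k _; rewrite -big_split /=; apply/eq_bigr => l _.
by rewrite mcoeffD raddfD mulrDl raddfD.
Qed.

Lemma mulSDDr : right_distributive mulSD +%R.
Proof.
move=> u v w; pose d := (msupp v `|` msupp w)%fset.
rewrite (@mulSDw (msupp u) d u v) ?fsubsetUl // (@mulSDw (msupp u) d u w) ?fsubsetUr //.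
rewrite (@mulSDw (msupp u) d) ?msuppD_le // -big_split /=.
apply/eq_bigr => k _; rewrite -big_split /=; apply/eq_bigr => l _.
by rewrite mcoeffD mulrDr raddfD.
Qed.

Lemma mulSD_suml (I : Type) (r : seq I) (f : I -> SD F) v :
  mulSD (\sum_(i <- r) f i) v = \sum_(i <- r) mulSD (f i) v.
Proof.
exact: (big_morph (mulSD^~ v) (fun _ _ => mulSDDl _ _ _) (mulSD0r _)).
Qed.

Lemma mulSD_sumr (I : Type) (r : seq I) (f : I -> SD F) v :
  mulSD v (\sum_(i <- r) f i) = \sum_(i <- r) mulSD v (f i).
Proof.
exact: (big_morph (mulSD v) (fun _ _ => mulSDDr _ _ _) (mulSDr0 _)).
Qed.

Lemma mulSDA : associative mulSD.
Proof.
move=> u v w; rewrite (termSDE u) !mulSD_suml; apply/eq_bigr => k1 _.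
rewrite (termSDE v) mulSD_suml !mulSD_sumr mulSD_suml; apply/eq_bigr => k2 _.
rewrite (termSDE w) !mulSD_sumr; apply/eq_bigr => k3 _.
by rewrite !mulSDTT rmorphM /= shiftSDD addrA mulrA.
Qed.

Lemma mul1SD : left_id oneSD mulSD.
Proof.
move=> u; rewrite [in RHS](termSDE u) [in LHS](termSDE u) mulSD_sumr.
by apply/eq_bigr => k _; rewrite mulSDTT rmorph1 mul1r add0r.
Qed.

Lemma mulSD1 : right_id oneSD mulSD.
Proof.
move=> u; rewrite [in RHS](termSDE u) [in LHS](termSDE u) mulSD_suml.
by apply/eq_bigr => k _; rewrite mulSDTT shiftSD0 mulr1 addr0.
Qed.

Lemma oneSD_neq0 : oneSD != 0.
Proof.
by apply/eqP => /malgP/(_ 0)/eqP; rewrite coefSDE eqxx mcoeff0 oner_eq0.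
Qed.

HB.instance Definition _ := GRing.Zmodule_isNzRing.Build (SD F)
  mulSDA mul1SD mulSD1 mulSDDl mulSDDr oneSD_neq0.

Lemma scaleSDE c u k : (scaleSD c u)@_k = c%:P *: u@_k.
Proof.
rewrite [in RHS](termSDE u) /scaleSD !raddf_sum /=.
by apply/eq_bigr => i _; rewrite !coefSDE scalerMnr.
Qed.

Lemma scaleSDA c d u : scaleSD c (scaleSD d u) = scaleSD (c * d) u.
Proof. by apply/SD_ext => k; rewrite !scaleSDE scalerA -polyCM. Qed.

Lemma scale1SD : left_id 1 scaleSD.
Proof. by move=> u; apply/SD_ext => k; rewrite scaleSDE scale1r. Qed.

Lemma scaleSDDr : right_distributive scaleSD +%R.
Proof.
by move=> c u v; apply/SD_ext => k; rewrite scaleSDE !mcoeffD !scaleSDE scalerDr.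
Qed.

Lemma scaleSDDl u : {morph scaleSD^~ u : c d / c + d}.
Proof.
move=> c d; apply/SD_ext => k.
by rewrite mcoeffD !scaleSDE polyCD scalerDl.
Qed.

HB.instance Definition _ := GRing.Zmodule_isLmodule.Build F (SD F)
  scaleSDA scale1SD scaleSDDr scaleSDDl.

Lemma coefSDZ c u k : (c *: u)@_k = c%:P *: u@_k.
Proof. exact: scaleSDE. Qed.

Lemma termSDZ c k A : c *: termSD k A = termSD k (c%:P *: A).
Proof. by apply/SD_ext => l; rewrite coefSDZ !coefSDE scalerMnr. Qed.

Lemma termSDM k l A B :
  termSD k A * termSD l B = termSD (k + l) (shiftSD l A * B).
Proof. exact: mulSDTT. Qed.

Lemma scaleSDAl c u v : c *: (u * v) = c *: u * v.
Proof.
rewrite (termSDE u) mulr_suml !scaler_sumr mulr_suml; apply/eq_bigr => k _.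
rewrite (termSDE v) !mulr_sumr scaler_sumr; apply/eq_bigr => l _.
by rewrite termSDZ !termSDM termSDZ shiftSDZ scalerAl.
Qed.

Lemma scaleSDAr c u v : c *: (u * v) = u * (c *: v).
Proof.
rewrite (termSDE u) !mulr_suml scaler_sumr; apply/eq_bigr => k _.
rewrite (termSDE v) mulr_sumr !scaler_sumr mulr_sumr; apply/eq_bigr => l _.
by rewrite termSDZ !termSDM termSDZ scalerAr.
Qed.

HB.instance Definition _ := GRing.Lmodule_isLalgebra.Build F (SD F) scaleSDAl.
HB.instance Definition _ := GRing.Lalgebra_isAlgebra.Build F (SD F) scaleSDAr.

End Algebra.

Section Generators.
Context (F : fieldType).

Definition tSD : SD F := termSD 1 1.
Definition tinvSD : SD F := termSD (-1) 1.
Definition DSD : SD F := termSD 0 'X%:M.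
Definition thetaSD : SD F := termSD 0 (delta_mx 1 0).
Definition dthetaSD : SD F := termSD 0 (delta_mx 0 1).

Definition tpowSD (k : int) : SD F :=
  match k with Posz n => tSD ^+ n | Negz n => tinvSD ^+ n.+1 end.

Lemma tpowSDE k : tpowSD k = termSD k 1.
Proof.
case: k => n /=.
  elim: n => [|n IHn]; first by rewrite expr0.
  by rewrite exprS IHn termSDM rmorph1 mulr1 -intS.
rewrite NegzE; elim: n => [|n IHn]; first by rewrite expr1.
by rewrite exprS IHn termSDM rmorph1 mulr1 [in RHS]intS opprD.
Qed.

Lemma termSD0_horner (f : {poly F}) : horner_alg DSD f = termSD 0 f%:M.
Proof.
elim/poly_ind: f => [|f c IHf].
  by rewrite !raddf0.
rewrite rmorphD rmorphM /= horner_algX horner_algC IHf termSDM shiftSD0.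
rewrite -mulmxE -scalar_mxM raddfD raddfD addr0 /=; congr (_ + _).
by rewrite -[1]/(termSD 0 1) termSDZ -scalemx1.
Qed.

Lemma tSDK : tinvSD * tSD = 1 /\ tSD * tinvSD = 1.
Proof. by rewrite /tinvSD /tSD !termSDM !rmorph1 mulr1. Qed.

Lemma DSD_tSD (f : {poly F}) :
  horner_alg DSD f * tSD = tSD * horner_alg (DSD + 1) f.
Proof.
have DtE : DSD * tSD = tSD * (DSD + 1).
  rewrite /DSD /tSD mulrDr mulr1 !termSDM rmorph1.
  rewrite mulr1 mul1r addr0 add0r -raddfD /=.
  congr (termSD _ _); apply/matrixP => i j.
  by rewrite !mxE raddfMn /= comp_polyX -mulrnDl.
elim/poly_ind: f => [|f c IHf]; first by rewrite !raddf0 mul0r mulr0.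
rewrite !rmorphD !rmorphM /= !horner_algX !horner_algC mulrDl mulrDr.
by rewrite -mulrA DtE mulrA IHf mulrA -scalerAl -scalerAr mul1r mulr1.
Qed.

Lemma thetaSD_sq : thetaSD * thetaSD = 0 /\ dthetaSD * dthetaSD = 0.
Proof.
rewrite /thetaSD /dthetaSD !termSDM !shiftSD0 -!mulmxE !mul_delta_mx_0 //.
by rewrite !raddf0.
Qed.

Lemma clifford_thetaSD : thetaSD * dthetaSD + dthetaSD * thetaSD = 1.
Proof.
rewrite /thetaSD /dthetaSD !termSDM !shiftSD0 -!mulmxE !mul_delta_mx addr0.
rewrite -raddfD; congr (termSD _ _); apply/matrixP => i j.
by rewrite !mxE; case: i j => [[|[|[]]] //= ?] [[|[|[]]] //= ?]; rewrite ?addr0 ?add0r.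
Qed.

Lemma ord2P (i : 'I_2) : {i = 0} + {i = 1}.
Proof. by case: i => [[|[|//]] lt_i]; [left|right]; apply/val_inj. Qed.

Lemma shift_delta k i j : shiftSD k (delta_mx i j : coefSD F) = delta_mx i j.
Proof. by rewrite /shiftSD map_delta_mx. Qed.

Lemma comm_thetaSD :
  [/\ GRing.comm thetaSD tSD, GRing.comm thetaSD DSD,
      GRing.comm dthetaSD tSD & GRing.comm dthetaSD DSD].
Proof.
split; rewrite /GRing.comm /thetaSD /dthetaSD /tSD /DSD !termSDM ?shiftSD0
  ?rmorph1 ?shift_delta ?mulr1 ?mul1r ?addr0 ?add0r //;
  by rewrite -!mulmxE scalar_mxC.
Qed.

(* The coefficients A i j are unique because t^k A(D) determines A. *)
Lemma normal_formSD k (A : coefSD F) :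
  termSD k A =
    dthetaSD * thetaSD * tpowSD k * horner_alg DSD (A 0 0)
    + dthetaSD * tpowSD k * horner_alg DSD (A 0 1)
    + thetaSD * tpowSD k * horner_alg DSD (A 1 0)
    + thetaSD * dthetaSD * tpowSD k * horner_alg DSD (A 1 1).
Proof.
rewrite /dthetaSD /thetaSD !tpowSDE !termSD0_horner !termSDM.
rewrite !rmorphM !rmorph1 /= !shift_delta !mulr1 !addr0 !add0r.
rewrite -!mulmxE !mul_delta_mx -!raddfD; congr (termSD _ _).
rewrite !mul_mx_scalar; apply/matrixP => i j; rewrite !mxE.
case: (ord2P i) => ->; case: (ord2P j) => -> /=;
  by rewrite ?mulr1 ?mulr0 ?addr0 ?add0r.
Qed.

End Generators.

Variant cliff := ThetaD | DTheta | Theta | Dee.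

Definition cliff_odd (e : cliff) : bool :=
  match e with ThetaD | DTheta => false | Theta | Dee => true end.

Definition cliff_wt (e : cliff) : rat :=
  match e with ThetaD | DTheta => 0 | Theta => 1 / 2 | Dee => - (1 / 2) end.

(* the Clifford monomial represented by the matrix unit E_ij *)
Definition cliff_at (i j : 'I_2) : cliff :=
  match i == 0, j == 0 with
  | true, true => DTheta | true, false => Dee
  | false, true => Theta | false, false => ThetaD
  end.

(* the notation with a bar over k: 0 if k is odd and 1 if k is even *)
Definition overline (k : int) : nat := if odd `|k|%N then 0 else 1.

Definition linear_span (F : fieldType) (V : lmodType F) (S : set V) : set V :=
  [set v | exists n (c : 'I_n -> F) (x : 'I_n -> V),
    (forall i, S (x i)) /\ v = \sum_i c i *: x i].

Section Gradings.
Context (F : fieldType).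

Definition cliffSD (e : cliff) : SD F :=
  match e with
  | ThetaD => thetaSD F * dthetaSD F
  | DTheta => dthetaSD F * thetaSD F
  | Theta => thetaSD F
  | Dee => dthetaSD F
  end.

Definition monoSD (k : int) (l : nat) (e : cliff) : SD F :=
  tpowSD F k * DSD F ^+ l * cliffSD e.

Definition paritySD (p : bool) : set (SD F) :=
  linear_span [set x | exists k l e, cliff_odd e = p /\ x = monoSD k l e].

(* the principal gradation, with degrees in Z/2 embedded in rat *)
Definition gradeSD (d : rat) : set (SD F) :=
  linear_span
    [set x | exists k l e, k%:~R + cliff_wt e = d /\ x = monoSD k l e].

Definition super_anti_morphism (s : SD F -> SD F) : Prop :=
  forall (p q : bool) (x y : SD F), paritySD p x -> paritySD q y ->
    s (x * y) = (-1) ^+ (p && q) *: (s y * s x).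

(* s is sigma_{--,a}; there is exactly one such map, by sigma_mm_exists and   *)
(* sigma_mm_unique below.                                                     *)
Definition is_sigma_mm (a : F) (s : {linear SD F -> SD F}) : Prop :=
  [/\ super_anti_morphism s,
      s (tSD F) = - tSD F,
      s (DSD F) = - DSD F + a%:A,
      s (thetaSD F) = - thetaSD F
    & s (dthetaSD F) = dthetaSD F].

(* SD^s *)
Definition SDsub (s : SD F -> SD F) : set (SD F) := [set e | s e = - e].

(* even (n = 0) and odd (n = 1) polynomials *)
Definition parity_poly (n : nat) : set {poly F} :=
  [set f | f \Po - 'X = (-1) ^+ n *: f].

Lemma monoSDE k l e :
  monoSD k l e = termSD k ('X^l *: match e with
    | ThetaD => delta_mx 1 1 | DTheta => delta_mx 0 0
    | Theta => delta_mx 1 0 | Dee => delta_mx 0 1 end).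
Proof.
rewrite /monoSD.
have -> : DSD F ^+ l = termSD 0 ('X^l)%:M.
  by rewrite -termSD0_horner rmorphXn /= horner_algX.
have -> : cliffSD e = termSD 0 (match e with
    | ThetaD => delta_mx 1 1 | DTheta => delta_mx 0 0
    | Theta => delta_mx 1 0 | Dee => delta_mx 0 1 end).
  case: e => //=; rewrite /thetaSD /dthetaSD termSDM shiftSD0;
  by rewrite -mulmxE mul_delta_mx.
rewrite tpowSDE !termSDM !shiftSD0 !addr0 mul1r.
by rewrite -mulmxE mul_scalar_mx.
Qed.

Lemma span_monoSD (P : int -> cliff -> Prop) u k i j :
  linear_span [set x | exists k l e, P k e /\ x = monoSD k l e] u ->
  u@_k i j != 0 ->
  P k (cliff_at i j).
Proof.
move=> [n [c [x [Px ->]]]].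
rewrite raddf_sum /= summxE => /eqP nz; apply: contrapT => nP; apply: nz.
apply: big1 => m _; have [k' [l [e [Pe ->]]]] := Px m.
rewrite monoSDE termSDZ coefSDE mulmxnE.
case: eqP => [kk'|_]; last by rewrite mulr0n.
rewrite mulr1n !mxE; subst k'.
case: (ord2P i) nP => ->; case: (ord2P j) => -> /=;
  by case: e Pe => //= Pe nP; rewrite ?mxE ?mulr0.
Qed.

Lemma span_monoSD1 (P : int -> cliff -> Prop) k l e : P k e ->
  linear_span [set x | exists k l e, P k e /\ x = monoSD k l e] (monoSD k l e).
Proof.
move=> Pe; exists 1, (fun=> 1), (fun=> monoSD k l e).
by split=> [_|]; [exists k, l, e | rewrite big_ord1 scale1r].
Qed.

Lemma linear_spanZD (V : lmodType F) (S : set V) (c : F) x y :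
  linear_span S x -> linear_span S y -> linear_span S (c *: x + y).
Proof.
move=> [m [d [f [Sf ->]]]] [n [d' [f' [Sf' ->]]]].
exists (m + n)%N, (fun i => match split i with inl i => c * d i | inr i => d' i end),
  (fun i => match split i with inl i => f i | inr i => f' i end).
split=> [i|]; first by case: split.
rewrite big_split_ord /= scaler_sumr; congr (_ + _); apply: eq_bigr => i _.
  by rewrite (unsplitK (inl i)) scalerA.
by rewrite (unsplitK (inr i)).
Qed.

Lemma linear_span_sum (V : lmodType F) (S : set V) (I : eqType) (r : seq I)
    (c : I -> F) (x : I -> V) :
  (forall i, i \in r -> c i != 0 -> linear_span S (x i)) ->
  linear_span S (\sum_(i <- r) c i *: x i).
Proof.
elim: r => [|i r IHr] Sx.
  rewrite big_nil; exists 0, (fun=> 0), (fun=> 0); split; first by case.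
  by rewrite big_ord0.
have {}IHr := IHr (fun j jr => Sx j (mem_behead (s := i :: r) jr)).
rewrite big_cons; have [->|ci] := eqVneq (c i) 0; first by rewrite scale0r add0r.
by apply: linear_spanZD => //; apply: Sx => //; rewrite mem_head.
Qed.

Lemma termSD_mono k (A : coefSD F) :
  termSD k A = \sum_i 1 *: \sum_j 1 *: \sum_(l < size (A i j))
                 (A i j)`_l *: monoSD k l (cliff_at i j).
Proof.
rewrite [in LHS](matrix_sum_delta A) raddf_sum; apply: eq_bigr => i _.
rewrite scale1r raddf_sum; apply: eq_bigr => j _.
rewrite scale1r -[in LHS](coefK (A i j)) poly_def scaler_suml raddf_sum.
apply: eq_bigr => l _; rewrite /= monoSDE termSDZ; congr termSD.
rewrite scalerA -mul_polyC; congr (_ *: _); rewrite /cliff_at.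
by case: (ord2P i) => ->; case: (ord2P j) => ->.
Qed.

Lemma span_monoSD_coef (P : int -> cliff -> Prop) (u : SD F) :
  (forall k (i j : 'I_2), u@_k i j != 0 -> P k (cliff_at i j)) ->
  linear_span [set x | exists k l e, P k e /\ x = monoSD k l e] u.
Proof.
move=> Pu; have -> : u = \sum_(k <- msupp u) 1 *: termSD k u@_k.
  by rewrite [LHS]termSDE; apply: eq_bigr => k _; rewrite scale1r.
apply: linear_span_sum => k _ _; rewrite termSD_mono.
apply: linear_span_sum => i _ _; apply: linear_span_sum => j _ _.
apply: linear_span_sum => l _ nz; apply: span_monoSD1; apply: Pu.
by apply: contra_neq nz => A0; have := congr1 (fun p : {poly F} => p`_l) A0; rewrite coef0.
Qed.

End Gradings.

Section Sigma.
Context (F : fieldType) (a : F).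
Implicit Types (A B : coefSD F) (k l : int) (u v : SD F).

Let st A : coefSD F :=
  \matrix_(i, j) (if i == j then A (1 - i) (1 - j)
                  else (-1) ^+ (i == 1) * A i j).
Let sub k : {poly F} := (a - k%:~R)%:P - 'X.
Let flip k A : coefSD F := ((-1) ^ k)%:P *: map_mx (comp_poly (sub k)) (st A).
Let sigma u : SD F := \sum_(k <- msupp u) termSD k (flip k u@_k).

Let flipD k A B : flip k (A + B) = flip k A + flip k B.
Proof.
apply/matrixP => i j; rewrite !mxE -mulrDr -comp_polyD.
by case: eqP => _; rewrite ?mulrDr.
Qed.

Let flipZ k (c : F) A : flip k (c%:P *: A) = c%:P *: flip k A.
Proof.
apply/matrixP => i j; rewrite !mxE [RHS]mulrCA; congr (_ * _).
rewrite -[in RHS](comp_polyC c (sub k)) -comp_polyM.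
by case: eqP => _ //; rewrite mulrCA.
Qed.

Let flip0 k : flip k 0 = 0.
Proof. by have := flipZ k 0 0; rewrite scale0r => ->; rewrite scale0r. Qed.

Let sigmaE u k : (sigma u)@_k = flip k u@_k.
Proof.
rewrite /sigma raddf_sum /=; case: (msuppP u) => [ku|kNu].
  rewrite (big_fsetD1 k) //= coefSDE eqxx big1_fset ?addr0 // => l.
  by rewrite in_fsetD1 coefSDE; case: eqP.
rewrite flip0 big1_fset // => l lu _; rewrite coefSDE.
by case: eqP => // lk; rewrite -lk lu in kNu.
Qed.

Let sigmaT k A : sigma (termSD k A) = termSD k (flip k A).
Proof.
by apply/SD_ext => l; rewrite sigmaE !coefSDE; case: eqP => [->|] //; rewrite flip0.
Qed.

Let sigma_linear : linear sigma.
Proof.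
move=> c u v; apply/SD_ext => k.
by rewrite mcoeffD coefSDZ !sigmaE mcoeffD coefSDZ flipD flipZ.
Qed.

Let matpar (p : bool) A := forall i j, A i j != 0 -> (i != j) = p.

Let matparN p A i j : matpar p A -> (i != j) != p -> A i j = 0.
Proof. by move=> pA; apply: contraNeq => /pA ->. Qed.

Let stM p q A B : matpar p A -> matpar q B ->
  st (A * B) = (-1) ^+ (p && q) *: (st B * st A).
Proof.
have sum2 (f : 'I_2 -> {poly F}) : \sum_i f i = f 0 + f 1.
  by rewrite !big_ord_recl big_ord0 addr0; congr (_ + f _); apply/val_inj.
move=> pA qB; apply/matrixP => i j; rewrite !mxE !sum2 !mxE.
have zA i' j' := @matparN p A i' j' pA; have zB i' j' := @matparN q B i' j' qB.
have d01 : (0 == 1 :> 'I_2) = false by [].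
have d10 : (1 == 0 :> 'I_2) = false by [].
have {zA}ZA : if p then ((A 0 0 = 0) * (A 1 1 = 0))%type
    else ((A 0 1 = 0) * (A 1 0 = 0))%type.
  by case: p zA {pA} => zA; split; apply: zA.
have {zB}ZB : if q then ((B 0 0 = 0) * (B 1 1 = 0))%type
    else ((B 0 1 = 0) * (B 1 0 = 0))%type.
  by case: q zB {qB} => zB; split; apply: zB.
case: (ord2P i) => ->; case: (ord2P j) => ->;
  rewrite ?eqxx ?d01 ?d10 ?subrr ?subr0;
  case: p q ZA ZB {pA qB} => [] [] /= ZA ZB;
  rewrite ?ZA ?ZB ?expr0 ?expr1; ring.
Qed.

Let st_shift k A : st (shiftSD k A) = shiftSD k (st A).
Proof.
apply/matrixP => i j; rewrite !mxE; case: eqP => _ //.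
by rewrite comp_polyM rmorphXn /= rmorphN rmorph1.
Qed.

Let flipM p q k l A B : matpar p A -> matpar q B ->
  flip (k + l) (shiftSD l A * B) =
    ((-1) ^+ (p && q))%:P *: (shiftSD k (flip l B) * flip k A).
Proof.
move=> pA qB; have pA' : matpar p (shiftSD l A).
  by move=> i j; rewrite mxE => nz; apply: pA; apply: contraNneq nz => ->; rewrite comp_poly0.
rewrite /flip (stM pA' qB) st_shift.
have -> : map_mx (comp_poly (sub (k + l)))
    ((-1) ^+ (p && q) *: (st B * shiftSD l (st A)))
  = (-1) ^+ (p && q) *: (map_mx (comp_poly (sub (k + l))) (st B) *
                         map_mx (comp_poly (sub (k + l))) (shiftSD l (st A))).
  by rewrite map_mxZ map_mxM; congr (_ *: _); rewrite rmorphXn rmorphN rmorph1.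
have -> : map_mx (comp_poly (sub (k + l))) (shiftSD l (st A))
        = map_mx (comp_poly (sub k)) (st A).
  apply/matrixP => i j; rewrite !mxE -comp_polyA; congr (_ \Po _).
  rewrite comp_polyD comp_polyX comp_polyC /sub !polyCB intrD polyCD; ring.
have -> : map_mx (comp_poly (sub (k + l))) (st B)
        = shiftSD k (map_mx (comp_poly (sub l)) (st B)).
  apply/matrixP => i j; rewrite !mxE -comp_polyA; congr (_ \Po _).
  rewrite /sub comp_polyB comp_polyX comp_polyC !polyCB intrD polyCD; ring.
rewrite shiftSDZ -scalerAl -scalerAr !scalerA; congr (_ *: _).
rewrite expfzDr ?oppr_eq0 ?oner_eq0 // !polyCM polyC_exp polyCN polyC1; ring.
Qed.

Let matpar_SD p u : paritySD p u -> forall k, matpar p u@_k.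
Proof.
move=> pu k i j nz.
have := @span_monoSD F (fun _ e => cliff_odd e = p) u k i j pu nz.
by case: (ord2P i) => ->; case: (ord2P j) => ->.
Qed.

Lemma sigma_mm_exists : exists s, is_sigma_mm a s.
Proof.
have [s sT] : exists s : {linear SD F -> SD F},
    forall k A, s (termSD k A) = termSD k (flip k A).
  pose s : {linear SD F -> SD F} :=
    HB.pack sigma (GRing.isLinear.Build F (SD F) (SD F) *:%R sigma sigma_linear).
  by exists s; apply: sigmaT.
exists s; split.
- move=> p q u v /matpar_SD pu /matpar_SD qv.
  have sS r f : s (\sum_(k <- r) termSD k (f k)) = \sum_(k <- r) s (termSD k (f k)).
    exact: linear_sum.
  suff key (d e : seq int) (A B : int -> coefSD F) :
      (forall k, matpar p (A k)) -> (forall l, matpar q (B l)) ->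
      let x := \sum_(k <- d) termSD k (A k) in
      let y := \sum_(l <- e) termSD l (B l) in
      s (x * y) = (-1) ^+ (p && q) *: (s y * s x).
    by have := key (msupp u) (msupp v) _ _ pu qv; rewrite /= -!termSDE.
  move=> pA qB /=; rewrite !sS mulr_suml linear_sum mulr_sumr scaler_sumr.
  apply: eq_bigr => k _.
  rewrite mulr_sumr linear_sum mulr_suml scaler_sumr; apply: eq_bigr => l _.
  rewrite termSDM !sT termSDM termSDZ [(l + k)%R]addrC.
  by rewrite (flipM k l (pA k) (qB l)).
- rewrite sT -raddfN; congr (termSD _ _); apply/matrixP => i j.
  case: (ord2P i) => ->; case: (ord2P j) => ->; rewrite !mxE /= ?subrr ?subr0;
  rewrite ?mulr1n ?mulr0n ?mulr0 ?rmorph1 ?rmorph0 ?mulr0 ?oppr0 //;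
  by rewrite expr1z polyCN polyC1 mulr1.
- rewrite /DSD sT -raddfN -[1]/(termSD 0 1) termSDZ -raddfD.
  congr (termSD _ _); apply/matrixP => i j.
  case: (ord2P i) => ->; case: (ord2P j) => ->; rewrite !mxE /= ?subrr ?subr0;
  rewrite ?mulr1n ?mulr0n ?mulr0 ?comp_poly0 ?mulr0 ?oppr0 ?addr0 //;
  by rewrite comp_polyX expr0z polyC1 /sub subr0; ring.
- rewrite /thetaSD sT -raddfN; congr (termSD _ _); apply/matrixP => i j.
  case: (ord2P i) => ->; case: (ord2P j) => ->; rewrite !mxE /= ?subrr ?subr0;
  rewrite ?mulr1n ?mulr0n ?mulr0 ?comp_poly0 ?mulr0 ?oppr0 //.
  by rewrite expr0z polyC1 mul1r mulr1 expr1 rmorphN rmorph1.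
- rewrite /dthetaSD sT; congr (termSD _ _); apply/matrixP => i j.
  case: (ord2P i) => ->; case: (ord2P j) => ->; rewrite !mxE /= ?subrr ?subr0;
  rewrite ?mulr1n ?mulr0n ?mulr0 ?comp_poly0 ?mulr0 ?oppr0 //.
  by rewrite expr0z polyC1 mul1r mulr1 expr0 rmorph1.
Qed.

Lemma sigma_mm_unique (s1 s2 : {linear SD F -> SD F}) :
  is_sigma_mm a s1 -> is_sigma_mm a s2 -> s1 =1 s2.
Proof.
have par p (x : SD F) : (forall k, matpar p x@_k) -> paritySD p x.
  move=> px; apply: (span_monoSD_coef (P := fun _ e => cliff_odd e = p)).
  by move=> k i j /px <-; case: (ord2P i) => ->; case: (ord2P j) => ->.
have parT p k A : matpar p A -> paritySD p (termSD k A).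
  move=> pA; apply: par => l i j; rewrite coefSDE mulmxnE.
  by case: (k == l); [exact: pA | rewrite mulr0n eqxx].
have par_scal k (f : {poly F}) : paritySD false (termSD k f%:M).
  by apply: parT => i j; rewrite mxE; case: (i == j); rewrite ?mulr0n ?eqxx.
have par1 k : paritySD false (termSD k (1 : coefSD F)) by exact: par_scal.
have par_th : paritySD true (thetaSD F).
  apply: parT => i j; rewrite mxE.
  by case: (ord2P i) => ->; case: (ord2P j) => ->; rewrite ?eqxx.
have par_dth : paritySD true (dthetaSD F).
  apply: parT => i j; rewrite mxE.
  by case: (ord2P i) => ->; case: (ord2P j) => ->; rewrite ?eqxx.
have parD (l : nat) : paritySD false (DSD F ^+ l).
  by rewrite -(horner_algX (DSD F)) -rmorphXn /= termSD0_horner; apply: par_scal.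
have s_1 (s : {linear SD F -> SD F}) : is_sigma_mm a s -> s 1 = 1.
  case=> sM _ _ sth sdth; rewrite -(clifford_thetaSD F) linearD.
  rewrite (sM _ _ _ _ par_th par_dth) (sM _ _ _ _ par_dth par_th) sth sdth.
  by rewrite expr1 !scaleN1r mulrN mulNr !opprK addrC.
have s_tinv (s : {linear SD F -> SD F}) : is_sigma_mm a s -> s (tinvSD F) = - tinvSD F.
  move=> sP; have s1E := s_1 s sP; case: sP => sM s_t _ _ _.
  have := sM _ _ _ _ (par1 1) (par1 (-1)).
  rewrite -/(tSD F) -/(tinvSD F) (proj2 (tSDK F)) s1E expr0 scale1r s_t mulrN.
  move/(congr1 ( *%R^~ (tinvSD F))).
  rewrite /= mul1r mulNr -mulrA (proj2 (tSDK F)) mulr1 => tinvE.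
  by rewrite [in RHS]tinvE opprK.
move=> S1 S2; pose Q x := s1 x = s2 x.
have QM p q x y : paritySD p x -> paritySD q y -> Q x -> Q y -> Q (x * y).
  move: S1 S2 => [sM1 _ _ _ _] [sM2 _ _ _ _] px qy Qx Qy.
  by rewrite /Q (sM1 _ _ _ _ px qy) (sM2 _ _ _ _ px qy) Qx Qy.
have Qt : Q (tSD F) by move: S1 S2 => [_ + _ _ _] [_ + _ _ _]; rewrite /Q => -> ->.
have QD : Q (DSD F) by move: S1 S2 => [_ _ + _ _] [_ _ + _ _]; rewrite /Q => -> ->.
have Qth : Q (thetaSD F).
  by move: S1 S2 => [_ _ _ + _] [_ _ _ + _]; rewrite /Q => -> ->.
have Qdth : Q (dthetaSD F).
  by move: S1 S2 => [_ _ _ _ +] [_ _ _ _ +]; rewrite /Q => -> ->.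
have Q1 : Q 1 by rewrite /Q !s_1.
have Qtinv : Q (tinvSD F) by rewrite /Q !s_tinv.
have Qtpow k : Q (tpowSD F k).
  have par_tpow k' : paritySD false (tpowSD F k') by rewrite tpowSDE.
  case: k => n.
    elim: n => [|n IHn] //; rewrite /= exprS.
    exact: QM (par1 1) (par_tpow (Posz n)) Qt IHn.
  elim: n => [|n IHn] //; rewrite /= exprS.
  exact: QM (par1 (-1)) (par_tpow (Negz n)) Qtinv IHn.
have QDn (l : nat) : Q (DSD F ^+ l).
  elim: l => [|l IHl] //; rewrite exprS.
  exact: QM (parD 1) (parD l) QD IHl.
have Qmono k (l : nat) e : Q (monoSD F k l e).
  have Qe : Q (cliffSD F e).
    case: e => //=; [exact: QM par_th par_dth Qth Qdth|].
    exact: QM par_dth par_th Qdth Qth.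
  have par_e : paritySD (cliff_odd e) (DSD F ^+ l * cliffSD F e).
    have -> : DSD F ^+ l * cliffSD F e = monoSD F 0 l e.
      by rewrite /monoSD tpowSDE mul1r.
    exact: (@span_monoSD1 F (fun _ e' => cliff_odd e' = cliff_odd e)).
  have par_e0 : paritySD (cliff_odd e) (cliffSD F e).
    have -> : cliffSD F e = monoSD F 0 0 e.
      by rewrite /monoSD tpowSDE expr0 !mul1r.
    exact: (@span_monoSD1 F (fun _ e' => cliff_odd e' = cliff_odd e)).
  have Qlast : Q (DSD F ^+ l * cliffSD F e) by exact: QM (parD l) par_e0 (QDn l) Qe.
  by rewrite /monoSD -mulrA; apply: QM par_e (Qtpow k) Qlast; rewrite tpowSDE.
move=> u; have [n [c [x [xP ->]]]] : linear_span
    [set x | exists k (l : nat) e, True /\ x = monoSD F k l e] u.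
  by apply: (span_monoSD_coef (P := fun _ _ => True)).
rewrite !linear_sum; apply: eq_bigr => i _; rewrite !linearZ /=.
by have [k [l [e [_ ->]]]] := xP i; rewrite Qmono.
Qed.

End Sigma.

(* Main.v *)
Require Import Defs.
From HB Require Import structures.
From mathcomp Require Import all_boot all_order all_algebra ring zify.
From mathcomp.multinomials Require Import monalg.
From mathcomp Require Import boolp classical_sets reals complex.
Set Implicit Arguments.
Unset Strict Implicit.
Unset Printing Implicit Defensive.
Import Order.TTheory GRing.Theory Num.Theory.
Local Open Scope ring_scope.
Local Open Scope classical_set_scope.

(** Let E_ij be the matrix units that represent d_theta theta, d_theta, theta
    and theta d_theta. Since sigma reverses products, it sends t^k f(D) to
    (-1)^k t^k f(a - k - D): one gets f(a - D) (-t)^k, and moving t^k to the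
    left shifts D by k. On the Clifford factor it exchanges theta d_theta and
    d_theta theta, changes the sign of theta and fixes d_theta. Hence
    [sigma_unitSD]: sigma sends the term t^k f(D) E_ij to plus or minus the
    term t^k f(a - k - D) E_i'j' of the same degree, and everything is governed
    by the substitution w |-> a - k - w on polynomials ([reflect_poly]), which
    is an involution.

    The principal gradation puts t^k f(D) E_00 and t^k f(D) E_11 in degree k,
    and theta t^k f(D) and d_theta t^k f(D) in degrees k + 1/2 and k - 1/2
    ([gradeSD_int], [gradeSD_half]). It remains to solve sigma(u) = - u on two
    pairs of terms.

    - In degree j, sigma exchanges the two terms. So f can be any polynomial,
      it determines the coefficient of theta d_theta, and the second of the two
      equations follows from the first because the reflection and the sign
      (-1)^j are involutive ([anti_invariant_int]).
    - In degree j - 1/2, sigma preserves the type of each term, and each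
      coefficient must be an eigenvector of the reflection about (a - k)/2,
      with k = j - 1 for theta and k = j for d_theta. The sign carried by theta
      makes up for the parity of j - 1, so both eigenvalues are -(-1)^j
      ([anti_invariant_half]). Translating the centre of the reflection to the
      origin turns this into ordinary evenness or oddness
      ([parity_poly_center]). *)

(** * Homogeneous terms *)

Section Terms.
Context (F : fieldType).
Implicit Types (u : SD F) (k l : int) (i j : 'I_2) (f g : {poly F}) (c : F).

(** The term t^k f(D) E_ij; by the normal form, these span the superalgebra. *)
Definition unitSD k i j f : SD F := termSD k (f *: delta_mx i j).

Lemma unitSD_is_linear k i j c f g :
  unitSD k i j (c *: f + g) = c *: unitSD k i j f + unitSD k i j g.
Proof. by rewrite /unitSD termSDZ -raddfD scalerA mul_polyC scalerDl. Qed.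

HB.instance Definition _ k i j :=
  GRing.isLinear.Build F {poly F} (SD F) *:%R (unitSD k i j)
    (unitSD_is_linear k i j).

Lemma unitSDN k i j f : - unitSD k i j f = unitSD k i j (- f).
Proof. by rewrite linearN. Qed.

Lemma unitSDZ k i j c f : c *: unitSD k i j f = unitSD k i j (c *: f).
Proof. by rewrite linearZ. Qed.

Lemma coef_unitSD k i j f l i' j' :
  (unitSD k i j f)@_l i' j' = f *+ [&& k == l, i == i' & j == j'].
Proof.
rewrite coefSDE mulmxnE !mxE [i' == i]eq_sym [j' == j]eq_sym.
by case: (k == l); case: (i == i'); case: (j == j') => /=;
  rewrite ?mulr0n ?mulr0 ?mul0rn ?mulr1 ?mulr1n.
Qed.

(** Stated with the coefficient of u itself, so that comparing u with the sum
    of some of its components becomes comparing one entry of u with multiples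
    of itself. *)
Lemma coef_component u k i j l i' j' :
  (unitSD k i j (u@_k i j))@_l i' j'
  = u@_l i' j' *+ [&& k == l, i == i' & j == j'].
Proof.
by rewrite coef_unitSD; case: and3P => // -[/eqP-> /eqP-> /eqP->].
Qed.

(** Distinct matrix units keep two terms independent, whatever the powers of t:
    this is how one equation in the superalgebra splits into two equations
    between polynomials. *)
Lemma unitSD_pair_inj k l i j i' j' f g f' g' : (i != i') || (j != j') ->
  unitSD k i j f + unitSD l i' j' g = unitSD k i j f' + unitSD l i' j' g' ->
  f = f' /\ g = g'.
Proof.
move=> neq E.
have {}E m p q : (unitSD k i j f)@_m p q + (unitSD l i' j' g)@_m p q
    = (unitSD k i j f')@_m p q + (unitSD l i' j' g')@_m p q.
  by have := congr1 (fun u : SD F => u@_m p q) E; rewrite !mcoeffD !mxE.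
have n1 : (i' == i) && (j' == j) = false.
  by rewrite [i' == i]eq_sym [j' == j]eq_sym; apply/negbTE; rewrite negb_and.
have n2 : (i == i') && (j == j') = false by apply/negbTE; rewrite negb_and.
split; [have := E k i j | have := E l i' j'];
  by rewrite !coef_unitSD !eqxx ?n1 ?n2 ?andbF ?addr0 ?add0r.
Qed.

(** Scalar matrices commute with matrix units, and matrix units are unchanged
    by the shift of D; this isolates the Clifford factor of a term. *)
Lemma unitSDM k i j f :
  unitSD k i j f = termSD 0 (delta_mx i j) * termSD k f%:M.
Proof. by rewrite termSDM shift_delta add0r -mulmxE mul_mx_scalar. Qed.

Lemma tpowSD_horner k f : tpowSD F k * horner_alg (DSD F) f = termSD k f%:M.
Proof. by rewrite tpowSDE termSD0_horner termSDM rmorph1 mul1r addr0. Qed.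

Lemma unitSD00 k f :
  dthetaSD F * thetaSD F * tpowSD F k * horner_alg (DSD F) f = unitSD k 0 0 f.
Proof.
rewrite -mulrA tpowSD_horner unitSDM /dthetaSD /thetaSD termSDM shiftSD0.
by rewrite -mulmxE mul_delta_mx.
Qed.

Lemma unitSD11 k f :
  thetaSD F * dthetaSD F * tpowSD F k * horner_alg (DSD F) f = unitSD k 1 1 f.
Proof.
rewrite -mulrA tpowSD_horner unitSDM /dthetaSD /thetaSD termSDM shiftSD0.
by rewrite -mulmxE mul_delta_mx.
Qed.

Lemma unitSD10 k f :
  thetaSD F * tpowSD F k * horner_alg (DSD F) f = unitSD k 1 0 f.
Proof. by rewrite -mulrA tpowSD_horner unitSDM. Qed.

Lemma unitSD01 k f :
  dthetaSD F * tpowSD F k * horner_alg (DSD F) f = unitSD k 0 1 f.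
Proof. by rewrite -mulrA tpowSD_horner unitSDM. Qed.

Lemma horner_alg_comp f g :
  horner_alg (horner_alg (DSD F) g) f = horner_alg (DSD F) (f \Po g).
Proof.
elim/poly_ind: f => [|f c IHf]; first by rewrite comp_poly0 !raddf0.
rewrite comp_polyD comp_polyM comp_polyX comp_polyC !rmorphD !rmorphM /=.
by rewrite !horner_algX !horner_algC IHf.
Qed.

Lemma paritySD_termSD (p : bool) k (A : coefSD F) :
  (forall i j, A i j != 0 -> (i != j) = p) -> paritySD p (termSD k A).
Proof.
move=> pA; apply: (span_monoSD_coef (P := fun _ e => cliff_odd e = p)).
move=> l i j; rewrite coefSDE mulmxnE; case: (k == l); last by rewrite eqxx.
by rewrite mulr1n => /pA <-; case: (ord2P i) => ->; case: (ord2P j) => ->.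
Qed.

Lemma paritySD_scalar k f : paritySD false (termSD k f%:M).
Proof.
apply: paritySD_termSD => i j; rewrite mxE.
by case: (i == j); rewrite ?mulr0n ?eqxx.
Qed.

Lemma paritySD_delta k i j : paritySD (i != j) (termSD k (delta_mx i j : coefSD F)).
Proof.
apply: paritySD_termSD => i' j'; rewrite mxE.
by have [->|_] := eqVneq i' i; have [->|_] := eqVneq j' j; rewrite ?eqxx.
Qed.

End Terms.

(** * Reflections of polynomials *)

Section ReflectPoly.
Context (F : fieldType) (a : F).
Implicit Types (k l : int) (f : {poly F}) (c : F).

(** The substitution w |-> a - k - w, that is, the reflection of the affine line
    about (a - k)/2. *)
Definition reflect_poly k f : {poly F} := f \Po ((a - k%:~R)%:P - 'X).

Lemma reflect_polyK k : involutive (reflect_poly k).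
Proof.
move=> f; rewrite /reflect_poly -comp_polyA comp_polyB comp_polyC comp_polyX.
by rewrite opprB addrC subrK comp_polyXr.
Qed.

Lemma reflect_polyZ k c f : reflect_poly k (c *: f) = c *: reflect_poly k f.
Proof. exact: comp_polyZ. Qed.

Lemma sqr_signz k : (-1) ^ k * (-1) ^ k = 1 :> F.
Proof. by rewrite -expfzMl mulrNN mulr1 exp1rz. Qed.

(** The hypothesis says that - c is the centre of the reflection, so the
    translation by c conjugates it to w |-> - w. *)
Lemma reflect_poly_center k c f : a - k%:~R = - (c + c) ->
  reflect_poly k (f \Po ('X + c%:P)) = (f \Po - 'X) \Po ('X + c%:P).
Proof.
move=> ec; rewrite /reflect_poly -!comp_polyA; congr (f \Po _).
have NX q : - 'X \Po q = - q :> {poly F} by rewrite raddfN /= comp_polyX.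
by rewrite NX ec comp_polyD comp_polyC comp_polyX polyCN polyCD; ring.
Qed.

Lemma comp_XaddC_inj c : injective (fun f => f \Po ('X + c%:P)).
Proof.
apply: (can_inj (g := fun f => f \Po ('X - c%:P))) => f.
by rewrite -comp_polyA comp_polyD comp_polyX comp_polyC subrK comp_polyXr.
Qed.

Lemma comp_XaddCK c f : (f \Po ('X - c%:P)) \Po ('X + c%:P) = f.
Proof.
by rewrite -comp_polyA comp_polyB comp_polyX comp_polyC addrK comp_polyXr.
Qed.

(** The bar is 0 on odd integers, so its parity is opposite to that of k. *)
Lemma sign_overline k : (-1) ^ k = - (-1) ^+ overline k :> F.
Proof.
have -> : (-1) ^ k = (-1) ^+ odd `|k| :> F.
  by rewrite signr_odd; case: k => n //=; rewrite NegzE -exprnN invr_sign.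
by rewrite /overline; case: odd; rewrite ?expr0 ?expr1 ?opprK.
Qed.

Lemma parity_poly_center k l c f : a - k%:~R = - (c + c) ->
  (-1) ^ l *: reflect_poly k (f \Po ('X + c%:P)) = - (f \Po ('X + c%:P))
  <-> parity_poly (overline l) f.
Proof.
move=> ec; rewrite (reflect_poly_center _ ec) sign_overline scaleNr.
rewrite /parity_poly /=; set e := (-1) ^+ overline l.
have ee : e * e = 1 by rewrite -expr2 sqrr_sign.
rewrite -comp_polyZ; split=> [/oppr_inj/comp_XaddC_inj fE|->].
  by rewrite -[in RHS]fE scalerA ee scale1r.
by rewrite scalerA ee scale1r.
Qed.

End ReflectPoly.

(** * Action of the anti-involution *)

Section Reflection.
Context (F : fieldType) (a : F) (s : {linear SD F -> SD F}).
Context (sP : is_sigma_mm a s).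
Implicit Types (k : int) (i j : 'I_2) (f : {poly F}).

Lemma sigma_even_left (q : bool) x y :
  paritySD false x -> paritySD q y -> s (x * y) = s y * s x.
Proof. by case: sP => sM _ _ _ _ px py; rewrite (sM _ _ _ _ px py) scale1r. Qed.

Lemma sigma_theta_dtheta :
  (s (thetaSD F * dthetaSD F) = dthetaSD F * thetaSD F) *
  (s (dthetaSD F * thetaSD F) = thetaSD F * dthetaSD F).
Proof.
have [sM _ _ s_th s_dth] := sP.
have pth : paritySD true (thetaSD F) by apply: (paritySD_delta F 0 1 0).
have pdth : paritySD true (dthetaSD F) by apply: (paritySD_delta F 0 0 1).
split.
  by rewrite (sM _ _ _ _ pth pdth) s_th s_dth /= expr1 scaleN1r mulrN opprK.
by rewrite (sM _ _ _ _ pdth pth) s_th s_dth /= expr1 scaleN1r mulNr opprK.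
Qed.

(** No multiplicativity axiom gives this value directly: 1 is recovered as
    theta d_theta + d_theta theta, whose two summands sigma exchanges. *)
Lemma sigma_1 : s 1 = 1.
Proof.
by rewrite -[in LHS](clifford_thetaSD F) linearD !sigma_theta_dtheta addrC
  clifford_thetaSD.
Qed.

(** The reflection of the 2 x 2 matrix units across the antidiagonal, with a
    sign on theta = E_10 only. *)
Lemma sigma_delta i j : s (termSD 0 (delta_mx i j))
  = (-1) ^+ ((i == 1) && (j == 0)) *: termSD 0 (delta_mx (1 - j) (1 - i)).
Proof.
have E10 : termSD 0 (delta_mx 1 0) = thetaSD F by [].
have E01 : termSD 0 (delta_mx 0 1) = dthetaSD F by [].
have E00 : termSD 0 (delta_mx 0 0) = dthetaSD F * thetaSD F.
  by rewrite /thetaSD /dthetaSD termSDM shiftSD0 -mulmxE mul_delta_mx.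
have E11 : termSD 0 (delta_mx 1 1) = thetaSD F * dthetaSD F.
  by rewrite /thetaSD /dthetaSD termSDM shiftSD0 -mulmxE mul_delta_mx.
have [_ _ _ s_th s_dth] := sP.
case: (ord2P i) => ->; case: (ord2P j) => ->;
  by rewrite ?subrr ?subr0 /= ?scale1r ?scaleN1r ?E00 ?E01 ?E10 ?E11
    ?sigma_theta_dtheta ?s_th ?s_dth.
Qed.

Lemma sigma_expr x n :
  (forall m, paritySD false (x ^+ m)) -> s (x ^+ n) = s x ^+ n.
Proof.
move=> px; elim: n => [|n IHn]; first by rewrite !expr0 sigma_1.
by rewrite exprS (sigma_even_left (px 1) (px n)) IHn exprSr.
Qed.

Lemma sigma_tpowSD k : s (tpowSD F k) = (-1) ^ k *: tpowSD F k.
Proof.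
have [_ s_t _ _ _] := sP.
have par_t l : paritySD false (tpowSD F l).
  by rewrite tpowSDE; apply: (paritySD_scalar l 1).
have s_tinv : s (tinvSD F) = - tinvSD F.
  (* 1 = sigma(t t^-1) = - sigma(t^-1) t, multiplied by t^-1 on the right *)
  have [_ ttinv] := tSDK F.
  have := sigma_even_left (par_t 1) (par_t (-1)).
  rewrite /= !expr1 ttinv sigma_1 s_t mulrN.
  move/(congr1 ( *%R^~ (tinvSD F))); rewrite /= mul1r mulNr -mulrA ttinv mulr1.
  by move=> {2}->; rewrite opprK.
case: k => n.
  by rewrite /= (sigma_expr _ (fun m : nat => par_t m)) s_t exprNn -signr_odd
    -exprnP -[in RHS]signr_odd scaler_sign mulr_sign.
have par_tinv m : paritySD false (tinvSD F ^+ m).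
  by case: m => [|m]; [exact: (par_t 0) | exact: (par_t (Negz m))].
by rewrite /= (sigma_expr _ par_tinv) s_tinv exprNn -signr_odd
  NegzE -exprnN -[in RHS]signr_odd invr_sign scaler_sign mulr_sign.
Qed.

Lemma sigma_horner f :
  s (horner_alg (DSD F) f) = horner_alg (DSD F) (f \Po (a%:P - 'X)).
Proof.
have [_ _ s_D _ _] := sP.
have par_D g : paritySD false (horner_alg (DSD F) g).
  by rewrite termSD0_horner; apply: paritySD_scalar.
have s_C c : s (c%:A) = c%:A by rewrite linearZ /= sigma_1.
elim/poly_ind: f => [|f c IHf]; first by rewrite comp_poly0 !raddf0.
rewrite comp_polyD comp_polyM comp_polyX comp_polyC !rmorphD [in RHS]mulrC.
rewrite linearD [in RHS]rmorphM rmorphB /= !horner_algC s_C; congr (_ + _).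
have := sigma_even_left (par_D f) (par_D 'X).
rewrite -rmorphM => ->; rewrite horner_algX s_D IHf.
by rewrite [in RHS]addrC.
Qed.

(** sigma reverses t^k f(D) into f(a - D) (-t)^k, and moving t^k back to the
    left replaces D by D + k. *)
Lemma sigma_scalar k f :
  s (termSD k f%:M) = (-1) ^ k *: termSD k (reflect_poly a k f)%:M.
Proof.
have par_t : paritySD false (tpowSD F k).
  by rewrite tpowSDE; apply: (paritySD_scalar k 1).
have par_f : paritySD false (horner_alg (DSD F) f).
  by rewrite termSD0_horner; apply: paritySD_scalar.
rewrite -tpowSD_horner (sigma_even_left par_t par_f) sigma_tpowSD sigma_horner.
rewrite -scalerAr tpowSDE termSD0_horner termSDM add0r mulr1 /shiftSD.
rewrite map_scalar_mx /reflect_poly /= -comp_polyA; congr (_ *: termSD k (_ \Po _)%:M).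
by rewrite comp_polyB comp_polyC comp_polyX polyCB opprD addrA addrAC.
Qed.

Lemma sigma_unitSD k i j f : s (unitSD k i j f) =
  (-1) ^+ ((i == 1) && (j == 0)) *: ((-1) ^ k *:
    unitSD k (1 - j) (1 - i) (reflect_poly a k f)).
Proof.
have par_f : paritySD false (termSD k f%:M) by apply: paritySD_scalar.
have [sM _ _ _ _] := sP.
rewrite unitSDM (sM _ _ _ _ (paritySD_delta F 0 i j) par_f) andbF scale1r.
rewrite sigma_scalar sigma_delta -scalerAl -scalerAr termSDM shiftSD0 addr0.
by rewrite -mulmxE mul_scalar_mx scalerA mulrC -scalerA.
Qed.

End Reflection.

(** * Homogeneous components *)

Section Grading.
Context (F : fieldType).
Implicit Types (u : SD F) (k l : int).

(** The monomials are a basis made of homogeneous elements, so an element has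
    degree d exactly when each matrix entry that it involves has weight d. *)
Lemma gradeSDP (d : rat) u : gradeSD d u <->
  forall l i j, u@_l i j != 0 -> l%:~R + cliff_wt (cliff_at i j) = d.
Proof.
split=> [gu l i j|ud].
  exact: (@span_monoSD F (fun k e => k%:~R + cliff_wt e = d) u).
exact: (span_monoSD_coef (P := fun k e => k%:~R + cliff_wt e = d)).
Qed.

(** This separates the degrees of even elements, which are integers, from
    those of odd elements. *)
Lemma intr_half_neq k l : (l%:~R + 1 / 2 == k%:~R :> rat) = false.
Proof.
apply/eqP => E; have /intr_inj : (2 * l + 1)%:~R = (2 * k)%:~R :> rat.
  by rewrite intrD !intrM -E; field.
lia.
Qed.

Lemma intr_wt_int k l i j :
  (l%:~R + cliff_wt (cliff_at i j) == k%:~R) = (l == k) && (i == j).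
Proof.
case: (ord2P i) => ->; case: (ord2P j) => -> /=; rewrite ?andbT ?andbF ?addr0 ?eqr_int //.
  by rewrite subr_eq eq_sym intr_half_neq.
exact: intr_half_neq.
Qed.

Lemma intr_wt_half k l i j :
  (l%:~R + cliff_wt (cliff_at i j) == k%:~R - 1 / 2)
  = [|| [&& l == k - 1, i == 1 & j == 0] | [&& l == k, i == 0 & j == 1]].
Proof.
case: (ord2P i) => ->; case: (ord2P j) => -> /=; rewrite ?andbT ?andbF ?orbF ?addr0.
- by rewrite eq_sym subr_eq eq_sym intr_half_neq.
- by rewrite (inj_eq (addIr _)) eqr_int.
- rewrite eq_sym subr_eq -addrA (_ : 1 / 2 + 1 / 2 = 1%:~R :> rat) // -intrD eqr_int.
  by rewrite -subr_eq eq_sym.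
- by rewrite eq_sym subr_eq eq_sym intr_half_neq.
Qed.

Lemma gradeSD_int k u :
  gradeSD k%:~R u <-> exists f g, u = unitSD k 0 0 f + unitSD k 1 1 g.
Proof.
rewrite gradeSDP; split=> [gu|[f [g ->]] l i j].
  exists (u@_k 0 0), (u@_k 1 1); apply: SD_ext => l; apply/matrixP => i j.
  rewrite mcoeffD mxE !coef_component; have := gu l i j.
  have [->|_ /(_ isT)/eqP] := eqVneq (u@_l i j) 0; first by rewrite !mul0rn addr0.
  rewrite intr_wt_int => /andP[/eqP-> /eqP->].
  by case: (ord2P j) => ->; rewrite !eqxx ?addr0 ?add0r.
rewrite mcoeffD mxE !coef_unitSD => nz; apply/eqP; rewrite intr_wt_int.
apply: contraNT nz; rewrite [k == l]eq_sym; case: (l == k) => /=; last by rewrite addr0.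
by case: (ord2P i) => ->; case: (ord2P j) => ->; rewrite ?addr0.
Qed.

(** theta has weight 1/2 and d_theta has weight - 1/2, so the two components
    sit over different powers of t. *)
Lemma gradeSD_half k u :
  gradeSD (k%:~R - 1 / 2) u <->
  exists f g, u = unitSD (k - 1) 1 0 f + unitSD k 0 1 g.
Proof.
have nk : (k - 1 == k) = false by apply/eqP; lia.
rewrite gradeSDP; split=> [gu|[f [g ->]] l i j].
  exists (u@_(k - 1) 1 0), (u@_k 0 1); apply: SD_ext => l; apply/matrixP => i j.
  rewrite mcoeffD mxE !coef_component; have := gu l i j.
  have [->|_ /(_ isT)/eqP] := eqVneq (u@_l i j) 0; first by rewrite !mul0rn addr0.
  rewrite intr_wt_half => /orP[] /and3P[/eqP-> /eqP-> /eqP->];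
    by rewrite ?eqxx ?andbF ?addr0 ?add0r.
rewrite mcoeffD mxE !coef_unitSD => nz; apply/eqP; rewrite intr_wt_half.
apply: contraNT nz; rewrite [k == l]eq_sym [k - 1 == l]eq_sym.
rewrite [1 == i]eq_sym [0 == i]eq_sym [1 == j]eq_sym [0 == j]eq_sym.
by rewrite negb_or => /andP[/negPf-> /negPf->]; rewrite addr0.
Qed.

End Grading.

(** * Anti-invariant elements *)

Section AntiInvariants.
Context (F : fieldType) (a : F) (s : {linear SD F -> SD F}).
Context (sP : is_sigma_mm a s).
Implicit Types (k : int) (f g : {poly F}).

Lemma sigma_unitSD00 k f :
  s (unitSD k 0 0 f) = unitSD k 1 1 ((-1) ^ k *: reflect_poly a k f).
Proof. by rewrite (sigma_unitSD sP) expr0 scale1r subr0 linearZ. Qed.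

Lemma sigma_unitSD11 k f :
  s (unitSD k 1 1 f) = unitSD k 0 0 ((-1) ^ k *: reflect_poly a k f).
Proof. by rewrite (sigma_unitSD sP) expr0 scale1r subrr linearZ. Qed.

Lemma sigma_unitSD01 k f :
  s (unitSD k 0 1 f) = unitSD k 0 1 ((-1) ^ k *: reflect_poly a k f).
Proof. by rewrite (sigma_unitSD sP) expr0 scale1r subrr subr0 linearZ. Qed.

Lemma sigma_unitSD10 k f :
  s (unitSD k 1 0 f) = unitSD k 1 0 (- ((-1) ^ k *: reflect_poly a k f)).
Proof.
by rewrite (sigma_unitSD sP) expr1 scaleN1r subrr subr0 -linearZ -linearN.
Qed.

(** The E_11 component of sigma(u) = - u is the stated equation; its E_00
    component is the image of that equation under an involution. *)
Lemma anti_invariant_int k f g :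
  SDsub s (unitSD k 0 0 f + unitSD k 1 1 g)
  <-> g = - ((-1) ^ k *: reflect_poly a k f).
Proof.
rewrite /SDsub /= linearD sigma_unitSD00 sigma_unitSD11 [LHS]addrC opprD !unitSDN.
split=> [/unitSD_pair_inj[] // _ ->|->]; rewrite opprK //.
by rewrite -scaleNr reflect_polyZ reflect_polyK scalerA mulrN sqr_signz scaleN1r.
Qed.

(** Both equations are written with the same sign (-1)^k: the sign that sigma
    puts on theta absorbs the difference between k - 1 and k. *)
Lemma anti_invariant_half k f g :
  SDsub s (unitSD (k - 1) 1 0 f + unitSD k 0 1 g)
  <-> (-1) ^ k *: reflect_poly a (k - 1) f = - f
      /\ (-1) ^ k *: reflect_poly a k g = - g.
Proof.
have ek : (-1) ^ k = - (-1) ^ (k - 1) :> F.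
  by rewrite expfzDr ?oppr_eq0 ?oner_eq0 // exprN1 invrN1 mulrN1 opprK.
rewrite /SDsub /= linearD sigma_unitSD10 sigma_unitSD01 opprD !unitSDN ek !scaleNr.
by split=> [/unitSD_pair_inj[]|[-> ->]].
Qed.

End AntiInvariants.

(** The parameters (j - a - 1)/2 and (j - a)/2 are the opposites of the centres
    of the reflections for k = j - 1 and k = j; their existence is what requires
    2 to be invertible. *)
Lemma anti_invariant_spaces (F : fieldType) (a : F) (j : int)
    (sigma : {linear SD F -> SD F}) (hsigma : is_sigma_mm a sigma) :
  2 != 0 :> F ->
  let t := tpowSD F in
  let D := DSD F in
  let theta := thetaSD F in
  let dtheta := dthetaSD F in
  SDsub sigma `&` gradeSD j%:~R =
    [set dtheta * theta * t j * horner_alg D f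
         - (-1) ^ j *: (theta * dtheta * t j
                        * horner_alg (- D - j%:~R + a%:A) f)
      | f in [set: {poly F}]]
  /\
  SDsub sigma `&` gradeSD (j%:~R - 1 / 2) =
    [set theta * t (j - 1) * horner_alg (D + ((j%:~R - a - 1) / 2)%:A) f
         + dtheta * t j * horner_alg (D + ((j%:~R - a) / 2)%:A) g
      | f in parity_poly (overline j) & g in parity_poly (overline j)].
Proof.
move=> nz2 t D theta dtheta.
have halfD (x : F) : x / 2 + x / 2 = x by rewrite -mulrDl -mulr2n -[x *+ 2]mulr_natr mulfK.
have reflE f : theta * dtheta * t j * horner_alg (- D - j%:~R + a%:A) f
    = unitSD j 1 1 (reflect_poly a j f).
  rewrite -unitSD11 -horner_alg_comp rmorphB /= horner_algC horner_algX.
  by rewrite scalerBl scaler_int addrC addrA [in RHS]addrAC.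
have elE f : dtheta * theta * t j * horner_alg D f
         - (-1) ^ j *: (theta * dtheta * t j
                        * horner_alg (- D - j%:~R + a%:A) f)
    = unitSD j 0 0 f + unitSD j 1 1 (- ((-1) ^ j *: reflect_poly a j f)).
  by rewrite -unitSDN -unitSDZ -reflE -unitSD00.
have shiftE c f : horner_alg (D + c%:A) f = horner_alg D (f \Po ('X + c%:P)).
  by rewrite -horner_alg_comp rmorphD /= horner_algX horner_algC.
have c1E : a - (j - 1)%:~R
    = - ((j%:~R - a - 1) / 2 + (j%:~R - a - 1) / 2).
  by rewrite halfD intrB; ring.
have c0E : a - j%:~R = - ((j%:~R - a) / 2 + (j%:~R - a) / 2).
  by rewrite halfD opprB.
have halfE f g : theta * t (j - 1) * horner_alg (D + ((j%:~R - a - 1) / 2)%:A) f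
         + dtheta * t j * horner_alg (D + ((j%:~R - a) / 2)%:A) g
    = unitSD (j - 1) 1 0 (f \Po ('X + ((j%:~R - a - 1) / 2)%:P))
      + unitSD j 0 1 (g \Po ('X + ((j%:~R - a) / 2)%:P)).
  by rewrite !shiftE -unitSD10 -unitSD01.
split; apply/seteqP; split=> u.
- move=> [su /gradeSD_int [f [g uE]]]; exists f => //.
  by move: su; rewrite elE uE => /(anti_invariant_int hsigma) ->.
- move=> [f _ <-]; rewrite elE; split.
    exact/(anti_invariant_int hsigma).
  by apply/gradeSD_int; exists f, (- ((-1) ^ j *: reflect_poly a j f)).
- move=> [su /gradeSD_half [f [g uE]]].
  (* translate f and g to the centres of their reflections *)
  move: su; rewrite uE -(comp_XaddCK ((j%:~R - a - 1) / 2) f).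
  rewrite -(comp_XaddCK ((j%:~R - a) / 2) g).
  set f' := f \Po _; set g' := g \Po _ => /(anti_invariant_half hsigma).
  move=> [/(parity_poly_center _ _ c1E) fp /(parity_poly_center _ _ c0E) gp].
  by exists f' => //; exists g' => //; rewrite halfE.
- move=> [f fp [g gp <-]]; rewrite halfE; split; last first.
    apply/gradeSD_half.
    by exists (f \Po ('X + ((j%:~R - a - 1) / 2)%:P)), (g \Po ('X + ((j%:~R - a) / 2)%:P)).
  apply/(anti_invariant_half hsigma).
  by split; [apply/(parity_poly_center _ _ c1E) | apply/(parity_poly_center _ _ c0E)].
Qed.

Theorem proposition4p5 (R : realType) (a : R[i]) (j : int)
    (sigma : {linear SD R[i] -> SD R[i]}) (hsigma : is_sigma_mm a sigma) :
  let t := tpowSD R[i] in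
  let D := DSD R[i] in
  let theta := thetaSD R[i] in
  let dtheta := dthetaSD R[i] in
  SDsub sigma `&` gradeSD j%:~R =
    [set dtheta * theta * t j * horner_alg D f
         - (-1) ^ j *: (theta * dtheta * t j
                        * horner_alg (- D - j%:~R + a%:A) f)
      | f in [set: {poly R[i]}]]
  /\
  SDsub sigma `&` gradeSD (j%:~R - 1 / 2) =
    [set theta * t (j - 1) * horner_alg (D + ((j%:~R - a - 1) / 2)%:A) f
         + dtheta * t j * horner_alg (D + ((j%:~R - a) / 2)%:A) g
      | f in parity_poly (overline j) & g in parity_poly (overline j)].
Proof. by apply: anti_invariant_spaces; rewrite ?pnatr_eq0. Qed.
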